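(* Let $q\in\mathbb{C}$ with $0<|q|<1$, let $a,b,c$ be integers with $a,c>0$ and $b>-\sqrt{ac}$. For $x,y\in\mathbb{C}\setminus\{0\}$, $$g_{a,b,c}(x,y,q)=\frac{q^{a+b+c}}{xy}\,g_{a,b,c}\left(\frac{q^{2a+b}}{x},\frac{q^{2c+b}}{y},q\right).$$
   Context: For $0<|q|<1$, $x,y\in\mathbb{C}\setminus\{0\}$ and integers $a,b,c$ with $a,c>0$, $b>-\sqrt{ac}$, define $$g_{a,b,c}(x,y,q):=\Big(\sum_{r,s\ge 0}+\sum_{r,s<0}\Big)(-1)^{r+s}x^ry^sq^{a\binom{r}{2}+brs+c\binom{s}{2}},$$ where $r,s$ run over integers and $\binom{n}{2}=n(n-1)/2$ for every $n\in\mathbb{Z}$. *)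

(* Defs.v *)
From mathcomp Require Export all_boot all_order all_algebra.
From mathcomp Require Export complex.
From mathcomp Require Export reals topology normedtype.
From mathcomp Require Import summability.

Set Implicit Arguments.
Unset Strict Implicit.
Unset Printing Implicit Defensive.

Import GRing.Theory Num.Theory.
Export numFieldNormedType.Exports.

Local Open Scope ring_scope.
Local Open Scope complex_scope.

(* The division by 2 is exact, also for n < 0. *)
Definition binz2 (n : int) : int := (n * (n - 1) %/ 2)%Z.

Definition g_term (R : realType) (a b c : int) (x y q : R[i])
    (rs : int * int) : R[i] :=
  let: (r, s) := rs in
  (-1) ^ (r + s) * x ^ r * y ^ s * q ^ (a * binz2 r + b * r * s + c * binz2 s).

(* Unconditional sum of f over the pairs satisfying P: the limit, in the norm
   topology of R[i], of the sums over finite sets of pairs ordered by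
   inclusion. It agrees with every iterated sum when f is absolutely summable,
   which is the case in g below as soon as 0 < |q| < 1, a > 0, c > 0,
   b > - sqrt (a c) and x, y are nonzero: the quadratic form
   a r^2 + 2 b r s + c s^2 is then positive for r s >= 0, (r, s) != (0, 0). *)
Definition sum_on (R : realType) (P : pred (int * int))
    (f : int * int -> R[i]) : R[i] :=
  @sum (int * int)%type R[i] R[i]^o (fun rs => if P rs then f rs else 0).

Definition g (R : realType) (a b c : int) (x y q : R[i]) : R[i] :=
  sum_on (fun rs => (0 <= rs.1) && (0 <= rs.2)) (g_term a b c x y q) +
  sum_on (fun rs => (rs.1 < 0) && (rs.2 < 0)) (g_term a b c x y q).

(* Main.v *)
Require Import Defs.
From mathcomp Require Import finmap boolp classical_sets filter summability.
From mathcomp Require Import ring zify.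

(* Under (r, s) -> (-1 - r, -1 - s), which exchanges the quadrants r, s >= 0
   and r, s < 0, the summand of g at (x, y) becomes q^(a+b+c)/(xy) times the
   summand at (q^(2a+b)/x, q^(2c+b)/y), because
   binom(-1-r, 2) = binom(r, 2) + 2r + 1. *)

Import GRing.Theory Num.Theory.
Local Open Scope ring_scope.
Local Open Scope complex_scope.

(* If f is not summable both sides are 0, the junk value of a divergent sum. *)
Lemma sumZ (I : choiceType) (K : numFieldType) (k : K) (f : I -> K^o) :
  k != 0 -> sum (fun i => k * f i : K^o) = k * sum f.
Proof.
move=> k0; rewrite /sum; have ? := @totally_filter I.
have -> : partial_sum (fun i => k * f i : K^o) =
      k \*: (partial_sum f : {fset I} -> K^o).
  by apply/funext => A; rewrite /partial_sum -mulr_sumr.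
have [cvgf|dvgf] := pselect (cvg (fmap (partial_sum f) (nbhs totally))).
  exact: limZl_tmp.
have dvgkf : ~ cvg (fmap (k \*: (partial_sum f : {fset I} -> K^o)) (nbhs totally)).
  by rewrite is_cvgZlE.
by rewrite (dvgP dvgf) (dvgP dvgkf) [RHS]mulr0.
Qed.

Lemma partial_sum_comp (I : choiceType) (V : zmodType) (h : I -> I)
    (f : I -> V) (A : {fset I}) :
  injective h -> partial_sum (f \o h) A = partial_sum f [fset h i | i in A]%fset.
Proof.
move=> h_inj; rewrite /partial_sum.
rewrite -(big_seq_fsetE _ A predT (f \o h)).
rewrite -(big_seq_fsetE _ [fset h i | i in A]%fset predT f).
by rewrite big_imfset //= => i j _ _ /h_inj.
Qed.

(** Taking images under [h] permutes the finite sets and preserves inclusion, so both nets of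
    partial sums generate the same filter. Hence the limits agree, convergent or not. *)
Lemma sum_reindex (I : choiceType) (K : numFieldType) (h : I -> I)
    (f : I -> K^o) :
  involutive h -> sum (f \o h) = sum f.
Proof.
move=> hK; have h_inj := inv_inj hK; rewrite /sum; congr (lim _).
have imK (A B : {fset I}) :
    (([fset h i | i in A] `<=` B) -> (A `<=` [fset h i | i in B]))%fset.
  move=> /fsubsetP AB; apply/fsubsetP => i iA.
  by apply/imfsetP; exists (h i); rewrite ?hK //= AB // in_imfset.
have im_im (A : {fset I}) : [fset h i | i in [fset h i | i in A]]%fset = A.
  apply/eqP; rewrite eqEfsubset (imK _ _ (fsubset_refl _)) andbT.
  by apply/fsubsetP => _ /imfsetP[_ /imfsetP[i /= iA ->] ->]; rewrite hK.
(* If a tail beyond [A] lies in [S] for one net, the tail beyond the image of [A] does for the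
   other: by [imK], the image of such a [B] contains [A]. *)
apply/seteqP; split=> S [A _ AS]; exists [fset h i | i in A]%fset => //= B.
  by move=> /imK /AS /=; rewrite (partial_sum_comp _ _ _ f _ h_inj) im_im.
by move=> /imK /AS /=; rewrite (partial_sum_comp _ _ _ f _ h_inj).
Qed.

(** The extension of [F] by zero off [P], composed with [h], is [k] times that of [G] off [Q]. *)
Lemma sum_on_reflect (R : realType) (P Q : pred (int * int))
    (h : int * int -> int * int) (k : R[i]) (F G : int * int -> R[i]) :
  involutive h -> k != 0 -> (forall rs, P (h rs) = Q rs) ->
  (forall rs, F (h rs) = k * G rs) -> sum_on P F = k * sum_on Q G.
Proof.
move=> hK k0 PQ FG; rewrite /sum_on -sumZ //.
have -> : (fun rs => k * (if Q rs then G rs else 0)) =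
    (fun rs => if P rs then F rs else 0) \o h.
  by apply/funext => rs /=; rewrite PQ FG; case: ifP => // _; rewrite mulr0.
by rewrite sum_reindex.
Qed.

Lemma binz2_reflect (n : int) : binz2 (- 1 - n) = binz2 n + 2 * n + 1.
Proof.
(* A multiple of 2 passes through the floor division; what remains is (n + 1)(n + 2) = n(n - 1) +
   2(2n + 1). *)
have -> : binz2 n + 2 * n + 1 = (n * (n - 1) + (2 * n + 1) * 2) %/ 2 :> int.
  by rewrite divzDr ?dvdz_mull ?mulzK // addrA.
by rewrite /binz2; congr (_ %/ _)%Z; ring.
Qed.

Definition reflect_pair (rs : int * int) : int * int := (- 1 - rs.1, - 1 - rs.2).

Lemma reflect_pairK : involutive reflect_pair.
Proof. by case=> r s; congr pair => /=; ring. Qed.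

Lemma g_term_reflect (R : realType) (a b c : int) (x y q : R[i])
    (rs : int * int) :
  q != 0 -> x != 0 -> y != 0 ->
  g_term a b c x y q (reflect_pair rs) =
    q ^ (a + b + c) / (x * y) *
      g_term a b c (q ^ (2 * a + b) / x) (q ^ (2 * c + b) / y) q rs.
Proof.
case: rs => r s q0 x0 y0; rewrite /g_term /= !binz2_reflect.
have signE : (-1) ^ (- 1 - r + (- 1 - s)) = (-1) ^ (r + s) :> R[i].
  (* The shift by -2 is even, and -1 is its own inverse, so the sign is unchanged. *)
  have -> : - 1 - r + (- 1 - s) = - 2 - (r + s) :> int by ring.
  rewrite expfzDr ?oppr_eq0 ?oner_eq0 // -exprz_inv invrN1.
  by rewrite (_ : (-1) ^ (- 2) = 1) ?mul1r // -exprz_inv invrN1 -exprnP sqrrN expr1n.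
have invE (z : R[i]) n : z != 0 -> z ^ (- 1 - n) = z^-1 * z^-1 ^ n.
  by move=> z0; rewrite expfzDr // -!exprz_inv expr1z.
rewrite signE !invE // !expfzMl !exprz_exp invfM.
(* Expanding b(1 + r)(1 + s) supplies the [b] in the prefactor and in both new arguments. *)
have -> : a * (binz2 r + 2 * r + 1) + b * (- 1 - r) * (- 1 - s) +
    c * (binz2 s + 2 * s + 1) =
  (a + b + c) + (2 * a + b) * r + (2 * c + b) * s +
    (a * binz2 r + b * r * s + c * binz2 s) by ring.
set E := (_ + c * binz2 s); rewrite (expfzDr _ E q0).
rewrite (expfzDr _ ((2 * c + b) * s) q0) (expfzDr _ ((2 * a + b) * r) q0).
by ring.
Qed.

Theorem proposition2p4 (R : realType) (q : R[i]) (hq0 : 0 < `|q|)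
    (hq1 : `|q| < 1) (a b c : int) (ha : 0 < a) (hc : 0 < c)
    (hb : - Num.sqrt ((a * c)%:~R : R) < b%:~R)
    (x y : R[i]) (hx : x != 0) (hy : y != 0) :
  g a b c x y q =
    q ^ (a + b + c) / (x * y) *
      g a b c (q ^ (2 * a + b) / x) (q ^ (2 * c + b) / y) q.
Proof.
have q0 : q != 0 by rewrite -normr_gt0.
set k := q ^ (a + b + c) / (x * y).
have k0 : k != 0 by rewrite mulf_neq0 ?invr_neq0 ?mulf_neq0 ?expfz_neq0.
have termE rs := g_term_reflect R a b c x y q rs q0 hx hy.
(* The swap pairs opposite quadrants: -1 - r >= 0 exactly when r < 0, so the axes are matched
   correctly. *)
rewrite /g mulrDr addrC; congr (_ + _);
  apply: (sum_on_reflect _ _ _ _ _ _ _ reflect_pairK k0 _ termE) => rs.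
  by rewrite /=; lia.
by rewrite /=; lia.
Qed.
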